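(* Let $k \geq 3$ and let $(a_1,a_2,\ldots,a_k)$ be a position of the game Max-Welter that is not of the form $(0,1,\ldots,k-2,k+i)$ for any integer $i \geq 0$. If $\mathcal{G}(a_1,a_2,\ldots,a_k) = 2$, then $a_k - a_{k-1} = 2$.
   Context: Max-Welter is played with a finite number of coins on a semi-infinite strip of squares labeled $0,1,2,3,\ldots$ from its left end, each square containing at most one coin. A position with $k$ coins in squares $a_1<a_2<\cdots<a_k$ (nonnegative integers) is denoted $(a_1,a_2,\ldots,a_k)$. Two players move alternately; a move consists of taking the coin in the largest occupied square $a_k$ and moving it to any empty square on its left (jumping over other coins is legal). Only the rightmost coin of the current position may be moved; after a move the coins are re-indexed in increasing order. The player first unable to move loses. The Sprague-Grundy value $\mathcal{G}(p)$ of a position $p$ is defined recursively as the smallest nonnegative integer not equal to $\mathcal{G}(q)$ for any $q$ reachable from $p$ in one move (so a terminal position has value $0$). *)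

(* Defs.v *)
From mathcomp Require Import all_boot.

Set Implicit Arguments.
Unset Strict Implicit.
Unset Printing Implicit Defensive.

(* A position is the sequence of occupied squares in increasing order, that is
   an [s : seq nat] with [sorted ltn s]; its last item is the movable coin. *)

Definition options (s : seq nat) : seq (seq nat) :=
  let rest := take (size s).-1 s in
  [seq sort leq (rcons rest b) | b <- iota 0 (last 0 s) & b \notin rest].

Definition mex (s : seq nat) : nat :=
  find [pred n | n \notin s] (iota 0 (size s).+1).

(* Every move decreases the sum of the occupied squares, so [sumn s] is enough
   fuel; [grundyE] is the usual fuel-free recursion. *)
Fixpoint grundy_rec (fuel : nat) (s : seq nat) : nat :=
  if fuel is fuel'.+1 then mex [seq grundy_rec fuel' t | t <- options s] else 0.

Definition grundy (s : seq nat) : nat := grundy_rec (sumn s).+1 s.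

Lemma has_mex s : has [pred n | n \notin s] (iota 0 (size s).+1).
Proof.
apply/negPn/negP => /hasPn sub.
have /(uniq_leq_size (iota_uniq 0 _)) : {subset iota 0 (size s).+1 <= s}.
  by move=> n /sub /= /negPn.
by rewrite size_iota ltnn.
Qed.

Lemma mex_notin s : mex s \notin s.
Proof.
have := nth_find 0 (has_mex s); rewrite nth_iota //.
by have := has_mex s; rewrite has_find size_iota.
Qed.

Lemma mex_min s n : n \notin s -> mex s <= n.
Proof.
apply: contraNT; rewrite -ltnNge => lt_n.
have := before_find 0 lt_n; rewrite nth_iota.
  by move/negbFE.
by apply: ltn_trans lt_n _; have := has_mex s; rewrite has_find size_iota.
Qed.

Lemma options_sumn s t : t \in options s -> sumn t < sumn s.
Proof.
case/mapP=> b; rewrite mem_filter mem_iota add0n => /andP[_ /= lt_b] ->.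
rewrite (perm_sumn (permEl (perm_sort _ _))) sumn_rcons.
case/lastP: s lt_b => [//|s x]; rewrite last_rcons size_rcons /= => lt_b.
by rewrite -cats1 take_size_cat // cats1 sumn_rcons ltn_add2l.
Qed.

Lemma options_position s t :
  sorted ltn s -> t \in options s -> sorted ltn t /\ size t = size s.
Proof.
rewrite ltn_sorted_uniq_leq => /andP[s_uniq _] /mapP[b].
rewrite mem_filter mem_iota add0n => /andP[b_free /= lt_b] ->.
rewrite ltn_sorted_uniq_leq sort_uniq rcons_uniq b_free take_uniq //=.
rewrite sort_sorted; last exact: leq_total.
split=> //; rewrite size_sort size_rcons size_takel ?leq_pred // prednK //.
by case: (s) lt_b.
Qed.

Lemma grundyE s : grundy s = mex [seq grundy t | t <- options s].
Proof.
suff fuelE m n u : sumn u < m -> sumn u < n -> grundy_rec m u = grundy_rec n u.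
  rewrite {1}/grundy /=; congr mex; apply/eq_in_map => t /options_sumn lt_ts.
  exact: fuelE.
elim: m n u => [//|m IHm] [//|n] u lt_um lt_un /=.
congr mex; apply/eq_in_map => t /options_sumn lt_tu.
by apply: IHm; apply: leq_trans lt_tu _.
Qed.

(* Main.v *)
Require Import Defs.
From mathcomp Require Import all_boot.
From mathcomp Require Import zify.

Set Implicit Arguments.
Unset Strict Implicit.
Unset Printing Implicit Defensive.

(* Let [R] be the coins other than the rightmost one, [p] the largest of them,
   and suppose that [R] is not an initial segment of the strip. The positions
   obtained by putting the last coin on an empty square to the left of [p]
   realise exactly one of the values 0 and 1. Hence with the last coin on
   [p + 1] one gets the other of these two values, with the last coin further to
   the right the value is at least 2, and the value 2 can then only appear on
   [p + 2]. The claim is proved by strong induction on [p], since moving the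
   last coin below [p] makes [p] the rightmost coin. *)

(** * Options and values of unordered positions *)

(* Keeping the coins unordered makes the roles of two coins interchangeable. *)
Definition value (s : seq nat) : nat := grundy (sort leq s).

Lemma value_perm s t : perm_eq s t -> value s = value t.
Proof.
move=> st; congr grundy; apply/perm_sortP => //.
- exact: leq_total.
- exact: leq_trans.
- exact: anti_leq.
Qed.

Lemma value_swap b c s : value (b :: c :: s) = value (c :: b :: s).
Proof. by apply: value_perm; rewrite -[b :: _]/([:: b] ++ [:: c] ++ s) perm_catCA. Qed.

Lemma sort_max x s : all (gtn x) s -> sort leq (x :: s) = rcons (sort leq s) x.
Proof.
move=> lt_s; apply: (sorted_eq leq_trans anti_leq).
- exact/sort_sorted/leq_total.
- rewrite (sorted_pairwise leq_trans) pairwise_rcons all_sort.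
  rewrite -(sorted_pairwise leq_trans) (sort_sorted leq_total) andbT.
  by apply: sub_all lt_s => b /ltnW.
- by rewrite perm_sort perm_sym perm_rcons perm_cons perm_sort.
Qed.

Lemma value_max x s : all (gtn x) s ->
  value (x :: s) = mex [seq value (b :: s) | b <- iota 0 x & b \notin s].
Proof.
move=> lt_s; rewrite /value grundyE sort_max // /options.
rewrite size_rcons last_rcons -cats1 take_size_cat // -map_comp.
congr mex; rewrite (eq_filter (a2 := fun b => b \notin s)); last first.
  by move=> b; rewrite mem_sort.
apply: eq_map => b; apply: value_perm.
by rewrite perm_rcons perm_cons perm_sort.
Qed.

Lemma value_neq x s b : all (gtn x) s -> b < x -> b \notin s ->
  value (b :: s) != value (x :: s).
Proof.
move=> lt_s lt_b b_s; rewrite (value_max lt_s); apply/eqP => eq_b.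
have /negP[] := mex_notin [seq value (c :: s) | c <- iota 0 x & c \notin s].
by rewrite -eq_b; apply: map_f; rewrite mem_filter b_s mem_iota.
Qed.

Lemma value_reach x s v : all (gtn x) s -> v < value (x :: s) ->
  exists b, [/\ b < x, b \notin s & value (b :: s) = v].
Proof.
move=> lt_s; rewrite (value_max lt_s) => lt_v.
have /mapP[b]: v \in [seq value (b :: s) | b <- iota 0 x & b \notin s].
  by apply: contraTT lt_v => /mex_min; rewrite -leqNgt.
by rewrite mem_filter mem_iota => /andP[b_s lt_b] ->; exists b.
Qed.

(** * Finite sets of squares below a bound *)

Lemma bounded_size m (s : seq nat) : uniq s -> all (gtn m) s -> size s <= m.
Proof.
move=> s_uniq /allP lt_s; rewrite -(size_iota 0 m); apply: uniq_leq_size => //.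
by move=> b /lt_s; rewrite mem_iota.
Qed.

Lemma bounded_gap m (s : seq nat) : size s < m -> exists2 b : nat, b < m & b \notin s.
Proof.
move=> lt_m; have /hasP[b]: has [pred n | n \notin s] (iota 0 m).
  apply: contraTT lt_m => /hasPn sub; rewrite -leqNgt -[leqLHS](size_iota 0).
  by apply: uniq_leq_size (iota_uniq _ _) _ => b /sub /negPn.
by rewrite mem_iota => lt_b b_s; exists b.
Qed.

Lemma bounded_notin m (s : seq nat) b : all (gtn m) s -> m <= b -> b \notin s.
Proof. by move=> lt_s le_b; apply/negP => /(allP lt_s) /=; rewrite ltnNge le_b. Qed.

Lemma bounded_pred m (s : seq nat) :
  all (gtn m.+1) s -> m \notin s -> all (gtn m) s.
Proof.
move=> lt_s m_s; apply/allP => b b_s; rewrite /= ltn_neqAle.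
by rewrite (memPn m_s) //; apply: (allP lt_s).
Qed.

(** The sum forces [u] and [v] to be 0 and 1 in some order; they will be the values of two options
    of a position of value [w]. *)
Lemma two_low_values u v w : u + v = 1 -> u != w -> v != w -> 1 < w.
Proof. lia. Qed.

Lemma max_split (s : seq nat) : uniq s -> s != [::] ->
  exists (p : nat) (r : seq nat), perm_eq s (p :: r) /\ all (gtn p) r.
Proof.
move=> s_uniq s_neq0; have: sorted ltn (sort leq s).
  by rewrite ltn_sorted_uniq_leq sort_uniq s_uniq sort_sorted //; apply: leq_total.
have: perm_eq s (sort leq s) by rewrite perm_sym perm_sort.
case/lastP: (sort leq s) => [|r p]; first by move/perm_nilP/eqP; rewrite (negPf s_neq0).
move=> s_rp; rewrite (sorted_pairwise ltn_trans) pairwise_rcons => /andP[lt_r _].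
by exists p, r; rewrite (permPl s_rp) perm_rcons.
Qed.

(** By pigeonhole only the squares from [size s] on are empty, so the last coin behaves like a Nim
    heap of size [x - size s]. *)
Lemma value_initial (s : seq nat) x : uniq s -> all (gtn (size s)) s -> size s <= x ->
  value (x :: s) = x - size s.
Proof.
move=> s_uniq lt_s; elim/ltn_ind: x => x IHx le_x.
have lt_sx : all (gtn x) s by apply: sub_all lt_s => b /leq_trans; apply.
have gap (b : nat) : b \notin s -> size s <= b.
  move=> b_s; rewrite leqNgt; apply/negP => lt_b.
  have := @bounded_size (size s) (b :: s).
  by rewrite /= b_s s_uniq lt_b lt_s ltnn => /(_ isT isT).
case: (ltngtP (value (x :: s)) (x - size s)) => // lt_v.
- have lt_b : size s + value (x :: s) < x by lia.
  have b_s : size s + value (x :: s) \notin s by apply/negP => /(allP lt_s) /=; lia.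
  by have := value_neq lt_sx lt_b b_s; rewrite IHx ?leq_addr // addKn eqxx.
- have [b [lt_b /gap le_b]] := value_reach lt_sx lt_v.
  by rewrite IHx //; lia.
Qed.

(** * The values 0 and 1 *)

(* The non-initial sets [m :: r] are those with [size r < m]. *)
Definition unique_low_value m (r : seq nat) := exists b0,
  [/\ b0 < m, b0 \notin r, value (b0 :: m :: r) < 2 &
      forall b, b < m -> b \notin r -> value (b :: m :: r) < 2 ->
      value (b :: m :: r) = value (b0 :: m :: r)].

(** An initial segment [s] fits as well: [value (m.+1 :: s)] is then 0 and no empty square [c]
    exists. *)
Definition adjacent_low_value m := forall s : seq nat, uniq s -> all (gtn m.+1) s ->
  m \in s -> value (m.+1 :: s) < 2 /\
    forall c, c < m -> c \notin s -> value (c :: s) < 2 ->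
    value (c :: s) + value (m.+1 :: s) = 1.

(** Square [m] is a gap, and [size s = m] says that [s] fills all the squares below it. *)
Definition distant_low_value m := forall s : seq nat, uniq s -> all (gtn m.+1) s ->
  m \notin s -> value (m.+1 :: s) < 2 -> value (m.+1 :: s) = 1 /\ size s = m.

(** If [n] is empty, [n] itself is the witness. If [n] is occupied, every empty square below [n.+1]
    gives a low value, and these values agree. *)
Lemma unique_low_value_step n (r : seq nat) :
    (forall m, m <= n -> adjacent_low_value m) -> distant_low_value n ->
    uniq r -> all (gtn n.+1) r -> size r < n.+1 ->
  unique_low_value n.+1 r.
Proof.
move=> adj dist r_uniq lt_r size_r.
(* Here [n.+1] is seen as the last coin and [b] as one of the others, the largest of which is
   [n]. *)
have adjn (b : nat) : uniq (b :: r) -> b < n.+1 -> n \in b :: r ->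
    value (b :: n.+1 :: r) < 2 /\
    forall c, c < n -> c \notin b :: r -> value (c :: b :: r) < 2 ->
    value (c :: b :: r) + value (b :: n.+1 :: r) = 1.
  move=> br_uniq lt_b n_br; rewrite value_swap.
  by apply: adj => //=; rewrite lt_b.
have [n_r|n_r] := boolP (n \in r); last first.
  have nr_uniq : uniq (n :: r) by rewrite /= n_r.
  have [] := adjn n nr_uniq (ltnSn n) (mem_head _ _).
  move=> lt2 compl; exists n; split=> // b lt_b b_r low_b.
  have [->//|b_n] := eqVneq b n.
  have br_uniq : uniq (b :: r) by rewrite /= b_r.
  have [] := dist (b :: r) br_uniq.
  - by rewrite /= lt_b.
  - by rewrite inE eq_sym negb_or b_n.
  - by rewrite value_swap.
  (* By its size [b :: r] fills the squares below [n]. Hence [b :: n :: r] has value 0, and its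
     complement, the value given by [n], is 1 too. *)
  rewrite value_swap => -> Es.
  have size_n : (size r).+1 = n by [].
  have lt_bn : b < n by lia.
  have v0 : value (b :: n :: r) = 0.
    rewrite value_swap value_initial ?Es ?subnn //=.
    by rewrite lt_bn bounded_pred.
  by have := compl b lt_bn; rewrite inE negb_or b_n b_r v0 add0n => /(_ isT isT) ->.
have [b0 lt_b0 b0_r] := bounded_gap size_r.
have low (b : nat) : b < n.+1 -> b \notin r -> value (b :: n.+1 :: r) < 2 /\
    forall c, c < n -> c \notin b :: r -> value (c :: b :: r) < 2 ->
    value (c :: b :: r) + value (b :: n.+1 :: r) = 1.
  move=> lt_b b_r; apply: adjn => //; first by rewrite /= b_r.
  by rewrite inE n_r orbT.
have neq_n (b : nat) : b \notin r -> b != n by apply: contraNneq => ->.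
exists b0; split=> //; first by case: (low b0).
suff agree : forall b c, b < n.+1 -> b \notin r -> c < n.+1 -> c \notin r ->
    value (b :: n.+1 :: r) = value (c :: n.+1 :: r).
  by move=> b lt_b b_r _; apply: agree.
(* For [n = 0] the size bound makes [r] empty, against [n \in r]. *)
case En: n => [|i]; first by move: size_r n_r; rewrite En; case: (r).
subst n.
(* The positions [b :: i.+2 :: r] and [c :: i.+2 :: r] are compared through
   [b :: c :: r], to which the rightmost coin of either can be moved. *)
have adjacent_agree (b c : nat) : b < i.+2 -> b \notin r -> c < i.+2 -> c \notin r ->
    i \in b :: c :: r -> value (b :: i.+2 :: r) = value (c :: i.+2 :: r).
  move=> lt_b b_r lt_c c_r n_bcr; have [->//|neq_bc] := eqVneq b c.
  have [bn cn] := (neq_n b b_r, neq_n c c_r).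
  have low_bc : value (b :: c :: r) < 2.
    (* Taking [i.+1] out of [r] as the last coin leaves [i] as the largest of the others, so
       [adjacent_low_value i] applies. *)
    have bcr : perm_eq (b :: c :: r) (i.+1 :: b :: c :: rem i.+1 r).
      apply: perm_trans (permEl (perm_catCA [:: b; c] [:: i.+1] _)).
      by rewrite /= !perm_cons perm_to_rem.
    rewrite (value_perm bcr); apply: (adj i (leqnSn i) _ _ _ _).1.
    - by rewrite /= !inE !(mem_rem_uniq _ r_uniq) !inE negb_or neq_bc (negPf b_r)
        (negPf c_r) !andbF rem_uniq.
    - apply/allP => d; rewrite !inE mem_rem_uniq // inE /=.
      by case/or3P=> [/eqP->|/eqP->|/andP[dn /(allP lt_r) /=]]; lia.
    - by move: n_bcr; rewrite !inE mem_rem_uniq // !inE (ltn_eqF (ltnSn i)).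
  have [_ /(_ c)] := low b lt_b b_r; have [_ /(_ b)] := low c lt_c c_r.
  rewrite !inE !negb_or [c == b]eq_sym neq_bc b_r c_r [value (c :: b :: _)]value_swap low_bc.
  by move=> /(_ _ isT isT) Eb /(_ _ isT isT) Ec; lia.
move=> b c lt_b b_r lt_c c_r.
have [i_r|i_r] := boolP (i \in r).
  by apply: adjacent_agree; rewrite // !inE i_r !orbT.
(* The square [i] is empty, hence a valid intermediate between [b] and [c]. *)
by transitivity (value (i :: i.+2 :: r)); apply: adjacent_agree;
  rewrite // !inE eqxx ?orbT.
Qed.

Lemma unique_low_value_of n p (r : seq nat) :
    (forall m, m <= n -> adjacent_low_value m /\ distant_low_value m) ->
    p <= n.+1 -> uniq r -> all (gtn p) r -> size r < p ->
  unique_low_value p r.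
Proof.
case: p => [//|p] IH le_p r_uniq lt_r size_r.
apply: unique_low_value_step => //; last by case: (IH p).
by move=> m le_m; case: (IH m) => //; lia.
Qed.

(** The coin on [m.+1] can reach exactly the empty squares below [m]. One of 0 and 1 occurs among
    their values and the other does not, so the mex is the missing one. *)
Lemma unique_low_valueP m r : all (gtn m) r -> unique_low_value m r ->
  value (m.+1 :: m :: r) < 2 /\
  forall b, b < m -> b \notin r -> value (b :: m :: r) < 2 ->
  value (b :: m :: r) + value (m.+1 :: m :: r) = 1.
Proof.
move=> lt_r [b0 [lt_b0 b0_r low0 only]].
have lt_mr : all (gtn m.+1) (m :: r).
  by rewrite /= ltnSn; apply: sub_all lt_r => b /ltnW.
have neq0 : value (b0 :: m :: r) != value (m.+1 :: m :: r).
  by apply: value_neq; rewrite // ?inE ?negb_or ?b0_r ?ltn_eqF //; lia.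
have low : value (m.+1 :: m :: r) < 2.
  rewrite ltnNge; apply/negP => high.
  have [|b []] := @value_reach m.+1 (m :: r) (1 - value (b0 :: m :: r)) lt_mr.
    by lia.
  rewrite inE negb_or => lt_b /andP[b_m b_r] eq_b.
  have := only b _ b_r; rewrite eq_b; lia.
split=> // b lt_b b_r low_b; have := only b lt_b b_r low_b; lia.
Qed.

(** The two claims are proved jointly because [unique_low_value p r] rests on both of them for
    smaller arguments. *)
Lemma low_value m : adjacent_low_value m /\ distant_low_value m.
Proof.
elim/ltn_ind: m => m IHm.
have ulv p (r : seq nat) : p <= m -> uniq r -> all (gtn p) r -> size r < p ->
    unique_low_value p r.
  case: m IHm => [_|m IHm]; first by case: p.
  by apply: unique_low_value_of => n le_n; apply: IHm.
split=> s s_uniq lt_s m_s.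
  have s_mr := perm_to_rem m_s; set r := rem m s in s_mr.
  have /andP[m_r r_uniq] : uniq (m :: r) by rewrite -(perm_uniq s_mr).
  have lt_r : all (gtn m) r.
    by apply: bounded_pred => //; move: lt_s; rewrite (perm_all _ s_mr) => /andP[].
  have val_s (c : nat) : value (c :: s) = value (c :: m :: r).
    by apply: value_perm; rewrite perm_cons.
  have [size_r|size_r] := ltnP (size r) m.
    have [low compl] := unique_low_valueP lt_r (ulv m r (leqnn m) r_uniq lt_r size_r).
    rewrite val_s; split=> // c lt_c; rewrite (perm_mem s_mr) inE negb_or val_s.
    by case/andP=> _; apply: compl.
  have Er : size r = m by apply/eqP; rewrite eqn_leq size_r bounded_size.
  have Es : size s = m.+1 by rewrite (perm_size s_mr) /= Er.
  (* All squares up to [m] are occupied: a free [c] would make [m.+2] distinct squares below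
     [m.+1]. *)
  rewrite value_initial ?Es // subnn; split=> // c lt_c c_s.
  have := @bounded_size m.+1 (c :: s).
  by rewrite /= c_s s_uniq lt_s Es ltnn (leqW lt_c) => /(_ isT isT).
have lt_sm := bounded_pred lt_s m_s.
have size_s := bounded_size s_uniq lt_sm.
have initial : all (gtn (size s)) s -> value (m.+1 :: s) < 2 ->
    value (m.+1 :: s) = 1 /\ size s = m.
  by move=> lt_ss; rewrite value_initial //; lia.
have [s0|s_neq0] := eqVneq s [::]; first by apply: initial; rewrite s0.
have [p [r [s_pr lt_r]]] := max_split s_uniq s_neq0.
have /andP[p_r r_uniq] : uniq (p :: r) by rewrite -(perm_uniq s_pr).
have lt_pr : all (gtn p.+1) (p :: r).
  by rewrite /= ltnSn; apply: sub_all lt_r => b /ltnW.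
have lt_pm : p < m by apply: (allP lt_sm); rewrite (perm_mem s_pr) mem_head.
have val_s (c : nat) : value (c :: s) = value (c :: p :: r).
  by apply: value_perm; rewrite perm_cons.
have [size_r|size_r] := ltnP (size r) p; last first.
  apply: initial; rewrite (perm_all _ s_pr) (perm_size s_pr).
  by apply: sub_all lt_pr => b /=; lia.
have ulv_p := ulv p r (ltnW lt_pm) r_uniq lt_r size_r.
have [low compl] := unique_low_valueP lt_r ulv_p.
(* Since [p < m], the last coin can move to both [b0] and [p.+1], whose values are 0 and 1 in some
   order. *)
have [b0 [lt_b0 b0_r low0 _]] := ulv_p.
have eq1 := compl b0 lt_b0 b0_r low0.
have neq_b (c : nat) : c < m.+1 -> c \notin p :: r ->
    value (c :: p :: r) != value (m.+1 :: s).
  by rewrite -val_s -(perm_mem s_pr); apply: value_neq.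
have p1_pr : p.+1 \notin p :: r := bounded_notin lt_pr (leqnn _).
have b0_pr : b0 \notin p :: r by rewrite inE negb_or b0_r ltn_eqF.
have lt_b0m : b0 < m.+1 := leqW (ltn_trans lt_b0 lt_pm).
have := two_low_values eq1 (neq_b b0 lt_b0m b0_pr) (neq_b p.+1 lt_pm p1_pr).
by move=> gt1; rewrite ltnNge gt1.
Qed.

(** * Positions of value 2 *)

Theorem proposition1 (k : nat) (a : k.-tuple nat)
    (hk : 3 <= k) (ha : sorted ltn a)
    (hform : ~ exists i : nat, a = rcons (iota 0 k.-1) (k + i) :> seq nat)
    (hG : grundy a = 2) :
  nth 0 a k.-1 - nth 0 a k.-2 = 2.
Proof.
case: a ha hform hG => a /= /eqP size_a; move: size_a.
case/lastP: a => [|a x]; first by move=> Ek; rewrite -Ek in hk.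
case/lastP: a => [|r p]; first by move=> Ek; rewrite -Ek in hk.
move=> Ek; subst k; rewrite !size_rcons /= nth_rcons size_rcons ltnn eqxx.
rewrite nth_rcons size_rcons ltnSn nth_rcons ltnn eqxx => a_sorted not_form hG.
have := a_sorted; rewrite (sorted_pairwise ltn_trans) pairwise_rcons all_rcons.
case/andP=> /andP[/= lt_px lt_rx] rp_pairwise.
have := rp_pairwise; rewrite pairwise_rcons => /andP[lt_r].
rewrite -!(sorted_pairwise ltn_trans) in rp_pairwise * => r_sorted.
have r_uniq : uniq r by apply: sorted_uniq r_sorted; [exact: ltn_trans | exact: ltnn].
have a_val : value (x :: p :: r) = 2.
  rewrite -hG; congr grundy; apply: (sorted_eq leq_trans anti_leq).
  - exact/sort_sorted/leq_total.
  - by move: a_sorted; rewrite ltn_sorted_uniq_leq => /andP[].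
  - by rewrite perm_sort perm_sym perm_rcons perm_cons perm_rcons.
have lt_pr : all (gtn p.+1) (p :: r).
  by rewrite /= ltnSn; apply: sub_all lt_r => b /ltnW.
have lt_xpr : all (gtn x) (p :: r) by rewrite /= lt_px.
have p_r : p \notin r := bounded_notin lt_r (leqnn p).
have pr_uniq : uniq (p :: r) by rewrite /= p_r.
have [size_r|size_r] := ltnP (size r) p; last first.
  have Er : size r = p by apply/eqP; rewrite eqn_leq size_r bounded_size.
  have Epr : size (p :: r) = p.+1 by rewrite /= Er.
  have Ex : x - p.+1 = 2 by rewrite -a_val value_initial ?Epr.
  have Erp : rcons r p = iota 0 p.+1.
    apply: (irr_sorted_eq ltn_trans ltnn rp_pairwise (iota_ltn_sorted _ _)).
    apply: (uniq_min_size _ _ _).2; first by rewrite rcons_uniq p_r.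
      by move=> b; rewrite mem_rcons mem_iota => /(allP lt_pr).
    by rewrite size_rcons size_iota Er.
  (* The number of coins is [p.+2], so the last coin on [p.+3] is the excluded form with [i = 1]. *)
  case: not_form; exists 1; have -> : x = p.+3 by lia.
  by rewrite Erp Er addn1.
have ulv : unique_low_value p r.
  by apply: (@unique_low_value_of p) => // m _; apply: low_value.
have [low1 compl] := unique_low_valueP lt_r ulv.
have [b0 [lt_b0 b0_r low0 _]] := ulv.
have eq1 := compl b0 lt_b0 b0_r low0.
have gap (c : nat) : p < c -> c \notin p :: r := bounded_notin lt_pr.
have b0_pr : b0 \notin p :: r by rewrite inE negb_or b0_r ltn_eqF.
have lt_p2 : all (gtn p.+2) (p :: r) by apply: sub_all lt_pr => b /ltnW.
have neq1 := value_neq lt_p2 (ltnSn p.+1) (gap p.+1 (ltnSn p)).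
have neq0 := value_neq lt_p2 (leqW (leqW lt_b0)) b0_pr.
have ge2 := two_low_values eq1 neq0 neq1.
case: (ltngtP x p.+2) => [lt_x|lt_x|->]; last by rewrite -addn2 addKn.
  have Ex : x = p.+1 by apply/eqP; rewrite eqn_leq lt_px -ltnS lt_x.
  by rewrite Ex in a_val; rewrite a_val in low1.
(* The option with the last coin on [p.+2] cannot have value 2, so its value exceeds 2. It thus has
   an option of value 2, which is also an option of the original position. *)
have := value_neq lt_xpr lt_x (gap _ (leqW (ltnSn p))).
rewrite a_val neq_ltn ltnNge ge2 /= => gt2.
have [b [lt_b b_pr Eb]] := value_reach lt_p2 gt2.
by have := value_neq lt_xpr (ltn_trans lt_b lt_x) b_pr; rewrite Eb a_val.
Qed.
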